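(* Let $d$ be even. For any integers $r,n_0,n_1\ge0$ such that $s=r+n_0+n_1\le d/2-\sqrt d+3/2$, we have $c(r,n_0,n_1)=c_+(r,n_0,n_1)$.
   Context: Let $d\ge2$ be even. Vectors in $\mathbb{R}^{d+1}$ have coordinates indexed $0,\dots,d$ and are written $(x_0,x)$. Let $K=\{(x_0,x)\in\mathbb{R}^{d+1}: \sum_{i\in S}x_i\le\frac d2x_0\text{ for all }S\subset\{1,\dots,d\}\text{ with }|S|=\frac d2+1,\ 0\le x\le x_0e\}$. $Q$ is the convex cone generated by all $(1,x)$, $x\in\{0,1\}^d$; $C^*=\{s:s^Tx\ge0\ \forall x\in C\}$. For a convex cone $K'\subseteq Q$: $M(K')$ is the set of real symmetric $(d+1)\times(d+1)$ matrices $Y$ with $Ye_0=\mathrm{diag}(Y)$ and $u^TYv\ge0$ for all $u\in Q^*,v\in K'^*$; $M_+(K')$ its positive semidefinite members; $N(K')=\{\mathrm{diag}(Y):Y\in M(K')\}$, $N_+(K')=\{\mathrm{diag}(Y):Y\in M_+(K')\}$; $N^0=N_+^0=\mathrm{id}$, $N^r(K')=N(N^{r-1}(K'))$, $N_+^r(K')=N_+(N_+^{r-1}(K'))$. For integers $r,n_0,n_1\ge0$ with $n_0+n_1<d$, $c(r,n_0,n_1)$ is the largest $\alpha\in\mathbb{R}$ such that $(1,x)\in N^r(K)$, where $x$ has $n_1$ coordinates equal to $1$, $n_0$ coordinates equal to $0$ and the remaining $d-n_0-n_1$ coordinates equal to $\alpha$ (by symmetry of $K$ the choice of positions is immaterial);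 $c_+(r,n_0,n_1)$ is defined in the same way with $N_+^r(K)$ in place of $N^r(K)$. *)

(* Defs.v *)
From mathcomp Require Import all_boot all_order all_algebra.
From mathcomp Require Import classical_sets reals.

Set Implicit Arguments.
Unset Strict Implicit.
Unset Printing Implicit Defensive.

Import Order.TTheory GRing.Theory Num.Theory.
Local Open Scope classical_set_scope.
Local Open Scope ring_scope.

Definition cone_gen (R : realType) (n : nat) (G : set 'cV[R]_n) :
    set 'cV[R]_n :=
  [set y | exists (k : nat) (lam : 'I_k -> R) (g : 'I_k -> 'cV[R]_n),
     (forall i, 0 <= lam i) /\ (forall i, G (g i)) /\
     y = \sum_(i < k) lam i *: g i].

Definition dual_cone (R : realType) (n : nat) (C : set 'cV[R]_n) :
    set 'cV[R]_n :=
  [set s | forall x, C x -> 0 <= (s^T *m x) 0 0].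

(* The point (1, x); 1 + d is convertible to d.+1, coordinate 0 is ord0 and
   coordinate i of x sits at index lift ord0 i. *)
Definition homog (R : realType) (d : nat) (x : 'cV[R]_d) : 'cV[R]_d.+1 :=
  col_mx (1%:M : 'M_1) x.

Definition Q (R : realType) (d : nat) : set 'cV[R]_d.+1 :=
  cone_gen [set homog x | x in
    [set x : 'cV[R]_d | forall i, x i 0 = 0 \/ x i 0 = 1]].

(* d./2 is d / 2 because d is even in the theorem. *)
Definition K (R : realType) (d : nat) : set 'cV[R]_d.+1 :=
  [set v | (forall S : {set 'I_d}, #|S| = (d./2).+1 ->
              \sum_(i in S) v (lift ord0 i) 0 <= (d./2)%:R * v ord0 0) /\
           (forall i : 'I_d, 0 <= v (lift ord0 i) 0 <= v ord0 0)].

Definition diag_vec (R : realType) (n : nat) (Y : 'M[R]_n) : 'cV[R]_n :=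
  \col_i Y i i.

Definition M (R : realType) (d : nat) (C : set 'cV[R]_d.+1) :
    set 'M[R]_d.+1 :=
  [set Y | Y^T = Y /\
           Y *m delta_mx ord0 0 = diag_vec Y /\
           (forall u v, dual_cone (@Q R d) u -> dual_cone C v ->
              0 <= (u^T *m Y *m v) 0 0)].

Definition psd (R : realType) (n : nat) (Y : 'M[R]_n) : Prop :=
  Y^T = Y /\ forall x : 'cV[R]_n, 0 <= (x^T *m Y *m x) 0 0.

Definition M_plus (R : realType) (d : nat) (C : set 'cV[R]_d.+1) :
    set 'M[R]_d.+1 :=
  [set Y | M C Y /\ psd Y].

Definition N (R : realType) (d : nat) (C : set 'cV[R]_d.+1) :
    set 'cV[R]_d.+1 :=
  [set diag_vec Y | Y in M C].

Definition N_plus (R : realType) (d : nat) (C : set 'cV[R]_d.+1) :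
    set 'cV[R]_d.+1 :=
  [set diag_vec Y | Y in M_plus C].

Definition pattern (R : realType) (d : nat) (J0 J1 : {set 'I_d}) (a : R) :
    'cV[R]_d :=
  \col_i (if i \in J1 then 1 else if i \in J0 then 0 else a).

(* a is the largest real whose pattern lies in C, for every placement J0, J1
   of the n0 zeros and the n1 ones.  Such an a is unique when n0 + n1 < d. *)
Definition is_largest_coord (R : realType) (d : nat) (C : set 'cV[R]_d.+1)
    (n0 n1 : nat) (a : R) : Prop :=
  forall J0 J1 : {set 'I_d}, #|J0| = n0 -> #|J1| = n1 -> J0 :&: J1 = finset.set0 ->
    C (homog (pattern J0 J1 a)) /\
    (forall b : R, C (homog (pattern J0 J1 b)) -> b <= a).

(* is_c d r n0 n1 a : "c(r, n0, n1) exists and equals a". *)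
Definition is_c (R : realType) (d r n0 n1 : nat) (a : R) : Prop :=
  is_largest_coord (iter r (@N R d) (@K R d)) n0 n1 a.

Definition is_c_plus (R : realType) (d r n0 n1 : nat) (a : R) : Prop :=
  is_largest_coord (iter r (@N_plus R d) (@K R d)) n0 n1 a.

(* Main.v *)
(* Both operators satisfy the same recursion
     c(r+1, n0, n1) = g / (1 - b + g),  b = c(r, n0, n1+1),  g = c(r, n0+1, n1).
   The upper bound comes from a linear inequality valid on N^r(K), obtained by
   combining the level r inequalities over the free coordinates.  The lower bound
   comes from the symmetric matrix Y whose columns Y e_i and Y (e_0 - e_i) are
   multiples of the optimal level r patterns; Y is positive semidefinite as soon
   as (m - 1)(g - b) <= 1, with m the number of free coordinates.  Each difference
   g - b is at most the larger of two differences one level below, so everything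
   reduces to level 0, where g - b = 1 / (t (t + 1)) with t = d/2 - n1; the
   hypothesis on r + n0 + n1 gives t (t + 1) >= d. *)

Require Import Defs.
From mathcomp Require Import all_boot all_order all_algebra.
From mathcomp Require Import classical_sets reals.
From mathcomp Require Import zify ring lra.

Set Implicit Arguments.
Unset Strict Implicit.

Import Order.TTheory GRing.Theory Num.Theory.
Local Open Scope ring_scope.

(** * Dual cones, membership in [M], and comparison of the two operators *)

Lemma homog0 (R : realType) (d : nat) (x : 'cV[R]_d) : homog x ord0 0 = 1.
Proof.
rewrite /homog; have -> : (ord0 : 'I_d.+1) = lshift d (ord0 : 'I_1) by apply/val_inj.
by rewrite (col_mxEu (1%:M : 'M_1)) mxE eqxx.
Qed.

Lemma homog_lift (R : realType) (d : nat) (x : 'cV[R]_d) (i : 'I_d) :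
  homog x (lift ord0 i) 0 = x i 0.
Proof.
rewrite /homog; have -> : lift ord0 i = rshift 1 i :> 'I_d.+1 by apply/val_inj.
by rewrite (col_mxEd (1%:M : 'M_1)).
Qed.

Lemma trmul_sum (R : realType) (n : nat) (u v : 'cV[R]_n) :
  (u^T *m v) 0 0 = \sum_i u i 0 * v i 0.
Proof. by rewrite mxE; apply: eq_bigr => i _; rewrite mxE. Qed.

Lemma trmul_recl (R : realType) (d : nat) (u v : 'cV[R]_d.+1) :
  (u^T *m v) 0 0 =
  u ord0 0 * v ord0 0 + \sum_i u (lift ord0 i) 0 * v (lift ord0 i) 0.
Proof. by rewrite trmul_sum big_ord_recl. Qed.

Lemma trmulC (R : realType) (n : nat) (u v : 'cV[R]_n) :
  (u^T *m v) 0 0 = (v^T *m u) 0 0.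
Proof. by rewrite !trmul_sum; apply: eq_bigr => i _; rewrite mulrC. Qed.

Lemma trdelta_mul (R : realType) (n : nat) (i : 'I_n) (v : 'cV[R]_n) :
  ((delta_mx i 0 : 'cV[R]_n)^T *m v) 0 0 = v i 0.
Proof. by rewrite trmx_delta -rowE mxE. Qed.

Lemma dual_cone_gen (R : realType) (n : nat) (G : set 'cV[R]_n) (s : 'cV[R]_n) :
  (forall x, G x -> 0 <= (s^T *m x) 0 0) -> dual_cone (cone_gen G) s.
Proof.
move=> sG _ [k [lam [g [lam0 [gG ->]]]]].
rewrite mulmx_sumr summxE; apply: sumr_ge0 => i _.
by rewrite -scalemxAr mxE mulr_ge0 ?sG.
Qed.

Lemma dual_Q_homog (R : realType) (d : nat) (u : 'cV[R]_d.+1) (x : 'cV[R]_d) :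
  dual_cone (@Q R d) u -> (forall i, x i 0 = 0 \/ x i 0 = 1) ->
  0 <= u ord0 0 + \sum_i u (lift ord0 i) 0 * x i 0.
Proof.
move=> uQ x01; have : 0 <= (u^T *m homog x) 0 0.
  apply: uQ; exists 1%N, (fun=> 1), (fun=> homog x).
  split=> [_|]; first exact: ler01.
  split=> [_|]; first by exists x.
  by rewrite big_ord1 scale1r.
rewrite trmul_recl homog0 mulr1; congr (_ <= _ + _).
by apply: eq_bigr => i _; rewrite homog_lift.
Qed.

Lemma dual_Q_delta (R : realType) (d : nat) (i : 'I_d) :
  dual_cone (@Q R d) (delta_mx (lift ord0 i) 0).
Proof.
apply: dual_cone_gen => _ [x x01 <-].
rewrite trdelta_mul homog_lift.
by case: (x01 i) => ->; rewrite ?ler01.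
Qed.

Lemma dual_Q_sub_delta (R : realType) (d : nat) (i : 'I_d) :
  dual_cone (@Q R d) (delta_mx ord0 0 - delta_mx (lift ord0 i) 0).
Proof.
apply: dual_cone_gen => _ [x x01 <-].
rewrite linearB mulmxBl mxE [X in _ + X]mxE !trdelta_mul homog0 homog_lift.
by case: (x01 i) => ->; rewrite ?subr0 ?subrr ?ler01.
Qed.

(* The extreme rays of Q^* are e_i and e_0 - e_i, so it is enough to test
   the vectors Y e_i and Y (e_0 - e_i) against C^*. *)
Lemma M_intro (R : realType) (d : nat) (C : set 'cV[R]_d.+1) (Y : 'M[R]_d.+1) :
  Y^T = Y -> Y *m delta_mx ord0 0 = diag_vec Y ->
  (forall v, dual_cone C v -> 0 <= (Y *m v) ord0 0 /\
     forall i, 0 <= (Y *m v) (lift ord0 i) 0 <= (Y *m v) ord0 0) ->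
  M C Y.
Proof.
move=> symY diagY Yv; split=> //; split=> // u v uQ /Yv[g0 gi].
rewrite -mulmxA trmul_recl.
set g := Y *m v in g0 gi *.
(* The vertex [x] selects the negative coordinates of [u]; replacing [g i] by [g 0] there and by 0
   elsewhere only lowers the pairing. *)
pose x : 'cV[R]_d := \col_i (u (lift ord0 i) 0 < 0)%R%:R.
have x01 i : x i 0 = 0 \/ x i 0 = 1 by rewrite mxE; case: (_ < _); [right|left].
have u0 := dual_Q_homog uQ x01.
apply: le_trans (mulr_ge0 u0 g0) _.
rewrite mulrDl lerD2l mulr_suml; apply: ler_sum => i _.
have /andP[gi0 gile] := gi i.
rewrite mxE; case: ltP => ui; rewrite /= ?mulr1 ?mulr0 ?mul0r.
  by apply: ler_wnM2l => //; apply: ltW.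
exact: mulr_ge0.
Qed.

Lemma dual_cone_sub (R : realType) (n : nat) (C D : set 'cV[R]_n) :
  (C `<=` D -> dual_cone D `<=` dual_cone C)%classic.
Proof. by move=> CD s sD x /CD /sD. Qed.

(** A larger cone has a smaller dual, hence imposes fewer constraints on [Y]. *)
Lemma N_plus_sub_N (R : realType) (d : nat) (C D : set 'cV[R]_d.+1) :
  (C `<=` D -> N_plus C `<=` N D)%classic.
Proof.
move=> CD _ [Y [[symY [diagY YC]] _] <-]; exists Y => //.
by split=> //; split=> // u v uQ /(dual_cone_sub CD); apply: YC.
Qed.

Lemma iter_N_plus_sub_N (R : realType) (d r : nat) (C : set 'cV[R]_d.+1) :
  (iter r (@N_plus R d) C `<=` iter r (@N R d) C)%classic.
Proof. by elim: r => //= r IH; apply: N_plus_sub_N. Qed.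

(** * Averaging over subsets of a finite set *)

Section SubsetSums.
Variables (R : realType) (I : finType).
Implicit Types (F : {set I}) (f : I -> R).

Lemma sumD1_sum F f :
  \sum_(i in F) \sum_(j in F :\ i) f j = (#|F|.-1)%:R * \sum_(j in F) f j.
Proof.
under eq_bigr => i iF do
  rewrite -[\sum_(j in F :\ i) _](addKr (f i)) -big_setD1 //=.
rewrite big_split /= sumrN sumr_const.
have [->|[i iF]] := set_0Vmem F; first by rewrite !big_set0 mulr0 oppr0 mul0rn addr0.
by rewrite (cardsD1 i F) iF add1n mulrS addKr mulr_natl /=.
Qed.

(** Induction on [#|F|]: the bounds for the sets [F :\ i] are added up, and each element of [F] is
    counted [#|F|.-1] times. *)
Lemma sum_le_of_subset_sums F f (p : nat) (B : R) :
  (0 < p <= #|F|)%N ->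
  (forall T : {set I}, T \subset F -> #|T| = p -> \sum_(i in T) f i <= B) ->
  p%:R * \sum_(i in F) f i <= #|F|%:R * B.
Proof.
move=> /andP[p0]; move cF: #|F| => q.
elim: q F cF => [|q IH] F cF; first by rewrite leqNgt p0.
rewrite leq_eqVlt => /orP[/eqP pq|pq] FT.
  by rewrite pq ler_wpM2l ?ler0n // FT ?cF ?pq.
have q0 : 0 < q%:R :> R by rewrite ltr0n (leq_trans p0).
rewrite -(ler_pM2l q0) mulrCA.
have -> : q%:R * \sum_(i in F) f i = \sum_(i in F) \sum_(j in F :\ i) f j.
  by rewrite sumD1_sum cF.
rewrite mulr_sumr.
apply: (@le_trans _ _ (\sum_(i in F) q%:R * B)).
  apply: ler_sum => i iF; apply: IH => //.
    by have := cardsD1 i F; rewrite iF cF => -[].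
  by move=> T TF; apply: FT (fintype.subset_trans TF (finset.subD1set _ _)).
by rewrite sumr_const cF -[leLHS]mulr_natl mulrCA.
Qed.

(** Cauchy-Schwarz against the all-ones vector, read off from the double sum of
    [(f i - f j) ^+ 2]. *)
Lemma sqr_sum_le F f :
  (\sum_(i in F) f i) ^+ 2 <= #|F|%:R * \sum_(i in F) f i ^+ 2.
Proof.
have : 0 <= \sum_(i in F) \sum_(j in F) (f i - f j) ^+ 2.
  by apply: sumr_ge0 => i _; apply: sumr_ge0 => j _; apply: sqr_ge0.
have -> : \sum_(i in F) \sum_(j in F) (f i - f j) ^+ 2 =
   2 * (#|F|%:R * \sum_(i in F) f i ^+ 2 - (\sum_(i in F) f i) ^+ 2).
  have inner i : \sum_(j in F) (f i - f j) ^+ 2 =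
      #|F|%:R * f i ^+ 2 - 2 * (\sum_(j in F) f j) * f i + \sum_(j in F) f j ^+ 2.
    under eq_bigr => j _ do rewrite sqrrB addrAC -addrA -mulr_natl mulrCA mulrA.
    by rewrite !big_split /= sumr_const sumrN -mulr_sumr -[_ *+ #|F|]mulr_natl; ring.
  under eq_bigr do rewrite inner.
  by rewrite !big_split /= sumr_const sumrN -!mulr_sumr -[_ *+ #|F|]mulr_natl; ring.
by rewrite pmulr_rge0 ?ltr0n // subr_ge0.
Qed.

End SubsetSums.

(** * The candidate value: range and differences *)

Section LiftedCoordinate.
Variables (R : realType) (k : nat).

(* The value of c(r, n0, n1) for d = 2k. *)
Fixpoint lifted_coord (r n0 n1 : nat) : R :=
  if r is r'.+1 then
    let b := lifted_coord r' n0 n1.+1 in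
    let g := lifted_coord r' n0.+1 n1 in
    g / (1 - b + g)
  else if (n0 < k)%N then (k - n1)%:R / (k - n1).+1%:R else 1.

Lemma lifted_coord0_01 n0 n1 : 0 <= lifted_coord 0 n0 n1 <= 1.
Proof.
rewrite /=; case: ifP => _; last by rewrite ler01 lexx.
by rewrite divr_ge0 ?ler0n // ler_pdivrMr ?ltr0n // mul1r ler_nat leqnSn.
Qed.

(* With x, y the two differences at level r and b the common middle value,
   the difference at level r + 1 is (x (1 - b) + y b + x y) / ((1 + x) (1 + y)). *)
Lemma next_diff_bounds (a b e Z : R) :
  0 <= b <= 1 -> 0 <= a - b <= Z -> 0 <= b - e <= Z ->
  0 <= a / (1 - b + a) - b / (1 - e + b) <= Z.
Proof.
move=> /andP[b0 b1] /andP[x0 xZ] /andP[y0 yZ].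
set x := a - b in x0 xZ; set y := b - e in y0 yZ.
have Dx : 0 < 1 + x by lra.
have Dy : 0 < 1 + y by lra.
have -> : a / (1 - b + a) - b / (1 - e + b) =
    (x * (1 - b) + y * b + x * y) / ((1 + x) * (1 + y)).
  rewrite /x /y in Dx Dy *; field.
  by rewrite !lt0r_neq0 //; lra.
have xy0 : 0 <= x * y by apply: mulr_ge0.
have xb : 0 <= x * (1 - b) by apply: mulr_ge0; lra.
have yb : 0 <= y * b by apply: mulr_ge0.
have D : 0 < (1 + x) * (1 + y) by apply: mulr_gt0.
have num0 : 0 <= x * (1 - b) + y * b + x * y by rewrite !addr_ge0.
rewrite (divr_ge0 num0 (ltW D)) /= ler_pdivrMr //.
(* The first three bounds give numerator <= Z + Z y; the other two make this at most Z (1 + x) (1 +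
   y). *)
have : x * (1 - b) <= Z * (1 - b) by apply: ler_wpM2r; lra.
have : y * b <= Z * b by apply: ler_wpM2r.
have : x * y <= Z * y by apply: ler_wpM2r.
have : 0 <= Z * x by apply: mulr_ge0; lra.
have : 0 <= Z * (x * y) by apply: mulr_ge0; lra.
by lra.
Qed.

(** The recursion lowers r and raises n0 or n1, so the total s is invariant. Both claims go
    together: the range at the next level needs g >= b for a positive denominator. *)
Lemma lifted_coord_bounds (Z : R) (s : nat) :
  (forall n0 n1, (n0 + n1).+1 = s ->
     0 <= lifted_coord 0 n0.+1 n1 - lifted_coord 0 n0 n1.+1 <= Z) ->
  forall r,
  (forall n0 n1, (r + n0 + n1)%N = s -> 0 <= lifted_coord r n0 n1 <= 1) /\
  (forall n0 n1, (r + n0 + n1).+1 = s ->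
     0 <= lifted_coord r n0.+1 n1 - lifted_coord r n0 n1.+1 <= Z).
Proof.
move=> base; elim=> [|r [IH01 IHd]].
  by split=> [n0 n1 _|]; [apply: lifted_coord0_01 | apply: base].
split=> n0 n1 rs /=.
  have /andP[b0 b1] : 0 <= lifted_coord r n0 n1.+1 <= 1 by apply: IH01; lia.
  have /andP[g0 g1] : 0 <= lifted_coord r n0.+1 n1 <= 1 by apply: IH01; lia.
  have /andP[gb _] := IHd n0 n1 rs.
  have D : 0 < 1 - lifted_coord r n0 n1.+1 + lifted_coord r n0.+1 n1 by lra.
  by rewrite (divr_ge0 g0 (ltW D)) /= ler_pdivrMr // mul1r; lra.
by apply: next_diff_bounds; [apply: IH01 | apply: IHd | apply: IHd]; lia.
Qed.

(** The bound 1 / (d - 1) is what semidefiniteness can afford, as at most d coordinates are free. It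
    follows from n1 < s, which makes the denominator at least (k - s + 1) (k - s + 2). *)
Lemma lifted_coord0_diff (s : nat) :
  (0 < k)%N -> (s <= k)%N -> (k.*2 <= (k - s).+1 * (k - s).+2)%N ->
  forall n0 n1, (n0 + n1).+1 = s ->
  0 <= lifted_coord 0 n0.+1 n1 - lifted_coord 0 n0 n1.+1 <= (k.*2.-1)%:R^-1.
Proof.
move=> k0 sk ku n0 n1 ns /=.

have -> : (n0 < k)%N by lia.
case: ltnP => [n0k|kn0].
  have [t tE] : exists t, (k - n1 = t.+1)%N by exists (k - n1).-1; lia.
  have -> : (k - n1.+1 = t)%N by lia.
  rewrite tE.
  have -> : (t.+1)%:R / (t.+2)%:R - t%:R / (t.+1)%:R = ((t.+1 * t.+2)%:R)^-1 :> R.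
    rewrite natrM -!natr1; have := ler0n R t => t0.
    by field; rewrite !lt0r_neq0 //; lra.
  rewrite invr_ge0 ler0n /= lef_pV2 ?posrE ?ltr0n ?ler_nat //; try lia.
  apply: leq_trans (leq_pred _) (leq_trans ku _).
  by apply: leq_mul; lia.
(* Here the first value is 1 by the other branch of the definition. This forces s = k and n1 = 0, so
   [ku] leaves only k = 1, where the gap is exactly 1. *)
have k1 : k = 1%N by nia.
have -> : (k - n1.+1 = 0)%N by lia.
by rewrite k1 mul0r subr0 invr1 ler01 lexx.
Qed.

End LiftedCoordinate.

(** * Patterns that belong to the relaxations *)

Section LowerBound.
Variables (R : realType) (d : nat).

(** The worst S contains J1 and avoids J0; with t = k - n1 its sum is n1 + (t + 1) t / (t + 1) = k.
    If n0 >= k, at most k coordinates are nonzero, so the value 1 is harmless. *)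
Lemma pattern_K (k : nat) (J0 J1 : {set 'I_d}) : d = k.*2 -> (#|J0| + #|J1| <= k)%N ->
  K (homog (pattern J0 J1 (lifted_coord R k 0 #|J0| #|J1|))).
Proof.
move=> dk nk; have /andP[c0 c1] := lifted_coord0_01 R k #|J0| #|J1|.
set c := lifted_coord _ _ _ _ _ in c0 c1 *.
split=> [S|i]; last first.
  rewrite homog0 homog_lift mxE.
  by case: ifP => _; [|case: ifP => _]; rewrite ?c0 ?lexx ?ler01.
have -> : d./2 = k by rewrite dk doubleK.
rewrite homog0 mulr1 => cS.
under eq_bigr do rewrite homog_lift mxE.
have [kn0|n0k] := leqP k #|J0|.
  have -> : k%:R = \sum_(i in ~: J0) (1 : R).
    rewrite sumr_const; congr (_ *+ _).
    by have := cardsC J0; rewrite card_ord; lia.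
  have -> : J1 = finset.set0 by apply/eqP; rewrite -cards_eq0; lia.
  rewrite big_mkcond [leRHS]big_mkcond; apply: ler_sum => i _.
  by rewrite !inE; case: (i \in S); case: (i \in J0); rewrite /= ?lexx ?ler01.
apply: (@le_trans _ _ (\sum_(i in S) (c + (i \in J1)%:R * (1 - c)))).
  apply: ler_sum => i _; case: (i \in J1); first by rewrite /=; lra.
  by case: ifP => _ /=; lra.
rewrite big_split /= sumr_const cS -mulr_suml.
have J1S : \sum_(i in S) (i \in J1)%:R <= #|J1|%:R :> R.
  rewrite -sum1_card natr_sum big_mkcond [leRHS]big_mkcond.
  by apply: ler_sum => i _; case: (i \in S); case: (i \in J1).
apply: le_trans (_ : c *+ k.+1 + #|J1|%:R * (1 - c) <= _).
  by rewrite lerD2l; apply: ler_wpM2r => //; lra.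
have [t tE] : exists t, (k = t + #|J1|)%N by exists (k - #|J1|)%N; lia.
have cE : c * (t%:R + 1) = t%:R.
  rewrite /c /= n0k tE addnK -natr1 divfK //.
  by rewrite lt0r_neq0 // ltr_wpDl ?ler0n.
by rewrite mulrS -[c *+ k]mulr_natr [in leRHS]tE [in c * _]tE natrD; lra.
Qed.

(* The certificate is Y = w w^T + a (b - a) p p^T + a (1 - b) diag(p), with w the
   pattern and p the indicator of the free coordinates. *)
Lemma N_plus_pattern (C : set 'cV[R]_d.+1) (J0 J1 : {set 'I_d}) (a b g : R) :
  J0 :&: J1 = finset.set0 -> (0 < #|~: (J0 :|: J1)|)%N ->
  0 <= a <= 1 -> 0 <= b <= 1 -> a * (1 - b + g) = g ->
  #|~: (J0 :|: J1)|%:R * (a - b) <= 1 - b ->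
  (forall i, i \in ~: (J0 :|: J1) ->
     C (homog (pattern J0 (i |: J1) b)) /\ C (homog (pattern (i |: J0) J1 g))) ->
  N_plus C (homog (pattern J0 J1 a)).
Proof.
set F := ~: _ => J01 F0 /andP[a0 a1] /andP[b0 b1] abg psd_cond FC.
pose w := homog (pattern J0 J1 a).
pose p (x : 'I_d.+1) : R := if unlift ord0 x is Some i then (i \in F)%:R else 0.
have p0 : p ord0 = 0 by rewrite /p unlift_none.
have pl i : p (lift ord0 i) = (i \in F)%:R by rewrite /p liftK.
have w0 : w ord0 0 = 1 by rewrite homog0.
have wl i : w (lift ord0 i) 0 = pattern J0 J1 a i 0 by rewrite homog_lift.
pose Y : 'M[R]_d.+1 := \matrix_(x, y)
  (w x 0 * w y 0 + p x * p y * (a * (b - a) + (x == y)%:R * (a * (1 - b)))).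
have Y0 x : Y x ord0 = w x 0 by rewrite mxE p0 w0; ring.
have symY : Y^T = Y.
  by apply/matrixP => x y; rewrite !mxE [y == x]eq_sym; ring.
have Y0r x : Y ord0 x = w x 0 by rewrite -Y0 -[in LHS]symY mxE.
have FE i : (i \in F) = ~~ (i \in J0) && ~~ (i \in J1).
  by rewrite !inE negb_or.
have Yd x : Y x x = w x 0.
  rewrite mxE eqxx; case: (unliftP ord0 x) => [i ->|->]; last first.
    by rewrite p0 w0; ring.
  rewrite pl wl mxE FE; case: (i \in J1); first by rewrite andbF /=; ring.
  by case: (i \in J0) => /=; ring.
have YF i y : i \in F ->
    Y (lift ord0 i) y = a * homog (pattern J0 (i |: J1) b) y 0.
  move=> iF; rewrite mxE pl wl iF mxE.
  have := iF; rewrite FE => /andP[/negbTE-> /negbTE->].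
  case: (unliftP ord0 y) => [j ->|->]; last by rewrite p0 w0 homog0; ring.
  rewrite pl wl homog_lift !mxE (inj_eq lift_inj) in_setU1 [j == i]eq_sym.
  have [<-|ij] := eqVneq i j.
    by have := iF; rewrite FE => /andP[/negbTE-> /negbTE->] /=; ring.
  by rewrite FE /=; case: (j \in J1); case: (j \in J0) => /=; ring.
have YF' i y : i \in F ->
    Y ord0 y - Y (lift ord0 i) y = (1 - a) * homog (pattern (i |: J0) J1 g) y 0.
  move=> iF; rewrite Y0r YF //.
  have := iF; rewrite FE => /andP[iJ0 iJ1].
  case: (unliftP ord0 y) => [j ->|->]; last by rewrite w0 !homog0; ring.
  rewrite wl !homog_lift !mxE !in_setU1.
  have [->|ij] := eqVneq j i; first by rewrite (negbTE iJ0) (negbTE iJ1) /=; ring.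
  (* At a free j the claim is a (1 - b) = (1 - a) g, which is [abg] rearranged. *)
  by rewrite /=; case: (j \in J1); case: (j \in J0) => /=; lra.
have sub_row v x x' : (Y *m v) x 0 - (Y *m v) x' 0 = \sum_y (Y x y - Y x' y) * v y 0.
  by rewrite !mxE -sumrB; apply: eq_bigr => y _; rewrite mulrBl.
exists Y; last by apply/matrixP => x y; rewrite (ord1 y) [LHS]mxE Yd.
split; last split=> // x.
  apply: M_intro => // [|v vC].
    by rewrite -colE; apply/matrixP => x y; rewrite (ord1 y) [LHS]mxE Y0 [RHS]mxE Yd.
  have pos i : i \in F -> 0 <= (Y *m v) (lift ord0 i) 0 <= (Y *m v) ord0 0.
    move=> iF; have [C1 C2] := FC i iF.
    apply/andP; split.
      have -> : (Y *m v) (lift ord0 i) 0 = a * (v^T *m homog (pattern J0 (i |: J1) b)) 0 0.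
        rewrite trmulC trmul_sum mulr_sumr mxE.
        by apply: eq_bigr => y _; rewrite YF // mulrA.
      by rewrite mulr_ge0 ?vC.
    rewrite -subr_ge0.
    have -> : (Y *m v) ord0 0 - (Y *m v) (lift ord0 i) 0 =
        (1 - a) * (v^T *m homog (pattern (i |: J0) J1 g)) 0 0.
      rewrite sub_row trmulC trmul_sum mulr_sumr.
      by apply: eq_bigr => y _; rewrite YF' // mulrA.
    by rewrite mulr_ge0 ?subr_ge0 ?vC.
  have Y00 : 0 <= (Y *m v) ord0 0.
    by have [i iF] := card_gt0P F0; have /andP[+ ] := pos i iF; apply: le_trans.
  (* At a fixed coordinate the row of [Y] is row 0 (on J1) or zero (on J0 only). *)
  split=> // i; have [iF|] := boolP (i \in F); first exact: pos.
  rewrite FE negb_and !negbK => iJ.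
  have [iJ1|iJ1] := boolP (i \in J1).
    have -> : (Y *m v) (lift ord0 i) 0 = (Y *m v) ord0 0.
      rewrite !mxE; apply: eq_bigr => y _; congr (_ * _).
      by rewrite Y0r mxE pl wl mxE FE iJ1 andbF /=; ring.
    by rewrite Y00 lexx.
  have -> : (Y *m v) (lift ord0 i) 0 = 0.
    rewrite mxE big1 // => y _.
    move: iJ; rewrite (negbTE iJ1) orbF => iJ0.
    by rewrite mxE pl wl mxE FE (negbTE iJ1) iJ0 /=; ring.
  by rewrite lexx Y00.
have pz (z : 'I_d.+1 -> R) : \sum_y p y * z y = \sum_(i in F) z (lift ord0 i).
  rewrite big_ord_recl p0 mul0r add0r [RHS]big_mkcond; apply: eq_bigr => i _.
  by rewrite pl; case: (i \in F); rewrite ?mul1r ?mul0r.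
have pp y : p y * p y = p y.
  by rewrite /p; case: unlift => [i|]; rewrite ?mulr0 // -natrM mulnb andbb.
set W := \sum_y w y 0 * x y 0.
set S := \sum_(i in F) x (lift ord0 i) 0.
set T := \sum_(i in F) x (lift ord0 i) 0 ^+ 2.
have Yx y : (Y *m x) y 0 =
    w y 0 * W + p y * (a * (b - a)) * S + p y * (a * (1 - b)) * x y 0.
  rewrite mxE /W /S -(pz (fun z => x z 0)) !mulr_sumr.
  have -> : p y * (a * (1 - b)) * x y 0 =
      \sum_z p y * p z * ((y == z)%:R * (a * (1 - b))) * x z 0.
    rewrite (bigD1 y) //= eqxx mul1r pp big1 ?addr0 // => z zy.
    by rewrite eq_sym (negbTE zy) mul0r mulr0 mul0r.
  by rewrite -!big_split /=; apply: eq_bigr => z _; rewrite mxE; ring.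
have -> : (x^T *m Y *m x) 0 0 = W ^+ 2 + a * ((b - a) * S ^+ 2 + (1 - b) * T).
  rewrite -mulmxA trmul_sum.
  under eq_bigr => y _ do rewrite Yx.
  rewrite /T -(pz (fun z => x z 0 ^+ 2)).
  transitivity (\sum_y (W * (w y 0 * x y 0) + a * (b - a) * S * (p y * x y 0) +
     a * (1 - b) * (p y * x y 0 ^+ 2))).
    by apply: eq_bigr => y _; ring.
  rewrite !big_split /= -!mulr_sumr -/W (pz (fun z => x z 0)) -/S.
  by ring.
have ST : S ^+ 2 <= #|F|%:R * T by apply: sqr_sum_le.
rewrite addr_ge0 ?sqr_ge0 // mulr_ge0 //.
(* After multiplication by m = [#|F|], [ST] bounds the remaining factor below by (1 - b - m (a - b))
   S^2, which [psd_cond] makes nonnegative. *)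
have m0 : 0 < #|F|%:R :> R by rewrite ltr0n.
rewrite -(pmulr_rge0 _ m0).
have h1 : (1 - b) * S ^+ 2 <= (1 - b) * (#|F|%:R * T) by apply: ler_wpM2l => //; lra.
have h2 : 0 <= (1 - b - #|F|%:R * (a - b)) * S ^+ 2.
  by rewrite mulr_ge0 ?sqr_ge0 // subr_ge0.
by lra.
Qed.

End LowerBound.

(** * Linear inequalities valid on the relaxations *)

Section UpperBound.
Variables (R : realType) (d : nat).

(* The linear form
     m c x_0 - sum_F x_i + L (sum_J0 x_i + sum_J1 (x_0 - x_i)),   m = |F|,
   where F is the complement of J0 and J1. *)
Definition facet_vec (J0 J1 : {set 'I_d}) (c L : R) : 'cV[R]_d.+1 :=
  \col_x if unlift ord0 x is Some i
         then if i \in J1 then - L else if i \in J0 then L else - 1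
         else #|~: (J0 :|: J1)|%:R * c + L * #|J1|%:R.

Lemma facet_vecE (J0 J1 : {set 'I_d}) (c L : R) (f : 'I_d.+1 -> R) :
  \sum_x f x * facet_vec J0 J1 c L x 0 =
  (#|~: (J0 :|: J1)|%:R * c + L * #|J1|%:R) * f ord0
  + \sum_i (if i \in J1 then - L else if i \in J0 then L else - 1) * f (lift ord0 i).
Proof.
rewrite big_ord_recl mxE unlift_none mulrC; congr (_ + _).
by apply: eq_bigr => i _; rewrite mxE liftK mulrC.
Qed.

Lemma sum_facet (J0 J1 : {set 'I_d}) (L : R) (f : 'I_d -> R) :
  \sum_i (if i \in J1 then - L else if i \in J0 then L else - 1) * f i =
  L * (\sum_i (if i \in J1 then - 1 else if i \in J0 then 1 else 0) * f i)
  - \sum_(i in ~: (J0 :|: J1)) f i.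
Proof.
rewrite mulr_sumr [X in _ = _ - X]big_mkcond -sumrB; apply: eq_bigr => i _.
by rewrite !inE; case: (i \in J1); case: (i \in J0) => /=; ring.
Qed.

Lemma cardsC_setU1 (J : {set 'I_d}) (i : 'I_d) :
  i \in ~: J -> #|~: J| = #|~: (i |: J)|.+1.
Proof. by move=> iJ; rewrite (cardsD1 i (~: J)) iJ finset.setCU finset.setIC -finset.setDE. Qed.

(* Adding the inequality for J1 + i applied to Y e_i to the one for J0 + i
   applied to Y (e_0 - e_i) cancels every entry Y i j with j != i; the result
   is then summed over the free coordinates i. *)
Lemma facet_N (C : set 'cV[R]_d.+1) (J0 J1 : {set 'I_d}) (b g L L' : R) :
  (1 < #|~: (J0 :|: J1)|)%N -> 0 < 1 - b + g ->
  (#|~: (J0 :|: J1)|.-1)%:R * (1 - b + g) * L = #|~: (J0 :|: J1)|%:R * L' ->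
  (forall i, i \in ~: (J0 :|: J1) ->
     dual_cone C (facet_vec J0 (i |: J1) b L') /\
     dual_cone C (facet_vec (i |: J0) J1 g L')) ->
  dual_cone (N C) (facet_vec J0 J1 (g / (1 - b + g)) L).
Proof.
set F := ~: _ => m1 D LL' FC _ [Y [symY [diagY YC]] <-].
have Y0 x : Y x ord0 = Y x x.
  by have := congr1 (fun M : 'cV[R]_d.+1 => M x 0) diagY; rewrite -colE mxE [RHS]mxE.
have Y0r x : Y ord0 x = Y x x by rewrite -Y0 -[in LHS]symY mxE.
rewrite trmulC trmul_sum.
under eq_bigr => x _ do rewrite [diag_vec Y x 0]mxE.
rewrite (facet_vecE _ _ _ _ (fun x => Y x x)) sum_facet -/F.
pose v (i : 'I_d) : R := Y (lift ord0 i) (lift ord0 i).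
set v0 : R := Y ord0 ord0; rewrite -/v.
set X := \sum_i _ * v i; set V := \sum_(i in F) v i.
move m1E : #|F|.-1 => m' in LL'.
have mE : #|F| = m'.+1 by rewrite -m1E prednK // ltnW.
have m'0 : 0 < m'%:R :> R by rewrite ltr0n; lia.
have step i : i \in F ->
    0 <= m'%:R * b * v i + m'%:R * g * (v0 - v i) + v i
         + (L' * (#|J1|%:R * v0 + X) - V).
  move=> iF; have [C1 C2] := FC i iF.
  have := iF; rewrite !inE negb_or => /andP[iJ0 iJ1].
  have := YC _ _ (dual_Q_delta i) C1.
  rewrite -mulmxA trdelta_mul mxE (facet_vecE _ _ _ _ (fun y => Y (lift ord0 i) y)).
  have := YC _ _ (dual_Q_sub_delta i) C2.
  rewrite -mulmxA linearB mulmxBl mxE [X in _ + X]mxE !trdelta_mul mxE [X in _ - X]mxE -sumrB.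
  under eq_bigr => y _ do rewrite -mulrBl.
  rewrite (facet_vecE _ _ _ _ (fun y => Y ord0 y - Y (lift ord0 i) y)).
  have c1 : #|~: (J0 :|: (i |: J1))| = m'.
    by move: mE; rewrite (cardsC_setU1 iF) finset.setUCA => -[].
  have c2 : #|~: (i |: J0 :|: J1)| = m'.
    by move: mE; rewrite (cardsC_setU1 iF) finset.setUA => -[].
  rewrite c1 c2 cardsU1 iJ1 natrD Y0 -/(v i) -/v0.
  (* The penalty at index i disappears: for Y e_i the coefficient -L' cancels the extra L' from
     [#|i |: J1|], and for Y (e_0 - e_i) the entry Y 0 i - Y i i is zero. *)
  rewrite (bigD1 i) //= [X in _ -> 0 <= _ + X -> _](bigD1 i) //=.
  rewrite !setU11 (negbTE iJ1) Y0r -/(v i).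
  set A := \sum_(j | j != i) _; set B := \sum_(j | j != i) _ => h1 h2.
  have AB : A + B = L' * X - V + v i.
    rewrite /X /V -sum_facet [in RHS](bigD1 i) //= (negbTE iJ0) (negbTE iJ1).
    rewrite mulN1r addrAC addNr add0r /A /B -big_split /=.
    apply: eq_bigr => j ji.
    by rewrite !in_setU1 (negbTE ji) /= Y0r -mulrDr subrK.
  by lra.
have : 0 <= \sum_(i in F) (m'%:R * b * v i + m'%:R * g * (v0 - v i) + v i
         + (L' * (#|J1|%:R * v0 + X) - V)).
  exact: sumr_ge0.
have -> : \sum_(i in F) (m'%:R * b * v i + m'%:R * g * (v0 - v i) + v i
         + (L' * (#|J1|%:R * v0 + X) - V)) =
    \sum_(i in F) ((m'%:R * (b - g) + 1) * v i +
       (m'%:R * g * v0 + (L' * (#|J1|%:R * v0 + X) - V))).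
  by apply: eq_bigr => i _; ring.
rewrite big_split /= -mulr_sumr -/V sumr_const -[_ *+ #|F|]mulr_natl.
(* The coefficient of V in the sum is (m - 1) (b - g) + 1 - m = -(m - 1) (1 - b + g), which fixes
   the scaling; [LL'] then matches the penalty terms. *)
move=> h; rewrite -(pmulr_rge0 _ (mulr_gt0 m'0 D)).
apply: le_trans h _; rewrite le_eqVlt; apply/orP; left; apply/eqP.
have -> : m'%:R * (1 - b + g) *
   ((#|F|%:R * (g / (1 - b + g)) + L * #|J1|%:R) * v0 + (L * X - V)) =
   m'%:R * #|F|%:R * g * v0 + (m'%:R * (1 - b + g) * L) * (#|J1|%:R * v0 + X)
   - m'%:R * (1 - b + g) * V.
  by field; rewrite lt0r_neq0.
by rewrite LL' mE -natr1; ring.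
Qed.

(** For n0 < k, the inequalities of [K] for J1 together with t + 1 free indices, t = k - n1, are
    averaged over all choices. The defect [D1] of J1 enters with a factor at most d, which L
    absorbs. For n0 >= k, x_i <= x_0 suffices. *)
Lemma facet_K (k : nat) (J0 J1 : {set 'I_d}) (L : R) :
  d = k.*2 -> (#|J0| + #|J1| <= k)%N -> J0 :&: J1 = finset.set0 -> d%:R <= L ->
  dual_cone (@K R d) (facet_vec J0 J1 (lifted_coord R k 0 #|J0| #|J1|) L).
Proof.
move=> dk nk J01 dL v [vS v01].
rewrite trmulC trmul_sum (facet_vecE _ _ _ _ (fun x => v x 0)) sum_facet.
set F := ~: _; set v0 := v ord0 0.
pose f i := v (lift ord0 i) 0; rewrite -/f.
set V := \sum_(i in F) _; set X := \sum_i _ * _.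
pose D1 := \sum_(i in J1) (v0 - f i).
have D1_0 : 0 <= D1.
  by apply: sumr_ge0 => i _; rewrite subr_ge0; have /andP[] := v01 i.
have XD : D1 <= #|J1|%:R * v0 + X.
  rewrite /D1 /X mulr_natl -sumr_const ![\sum_(i in J1) _]big_mkcond /= -big_split /=.
  apply: ler_sum => i _; have /andP[fi0 fi1] := v01 i; rewrite -/(f i) in fi0 fi1.
  rewrite -/(f i); case: (i \in J1) => /=; first by lra.
  by case: (i \in J0) => /=; lra.
have L0 : 0 <= L by apply: le_trans dL; apply: ler0n.
have cF : (#|F| + #|J0| + #|J1| = d)%N.
  have := cardsC (J0 :|: J1); rewrite cardsU J01 cards0 card_ord -/F; lia.
have L1 : L * D1 <= L * (#|J1|%:R * v0 + X) by apply: ler_wpM2l.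
suff : V <= #|F|%:R * lifted_coord R k 0 #|J0| #|J1| * v0 + L * D1 by lra.
rewrite /=; case: ltnP => [n0k|kn0]; last first.
  have : V <= \sum_(i in F) v0.
    by apply: ler_sum => i _; have /andP[] := v01 i.
  rewrite sumr_const -mulr_natl; have : 0 <= L * D1 by apply: mulr_ge0.
  by lra.
have [t tE] : exists t, (k = t + #|J1|)%N by exists (k - #|J1|)%N; lia.
rewrite [in (k - _)%N]tE addnK.
have t0 : 0 < t.+1%:R :> R by rewrite ltr0n.
have tF : (t < #|F|)%N by move: cF n0k tE dk; move: #|F| #|J0| #|J1|; lia.
have sub : t.+1%:R * V <= #|F|%:R * (t%:R * v0 + D1).
  apply: sum_le_of_subset_sums => [|T TF cT]; first exact: tF.
  have dT : [disjoint J1 & T].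
    rewrite disjoint_sym; apply: disjointWl TF _.
    by rewrite finset.disjoints_subset /F finset.setCS finset.subsetUr.
  have := vS (J1 :|: T).
  have -> : d./2 = k by rewrite dk doubleK.
  rewrite cardsU disjoint_setI0 // cards0 cT subn0.
  move=> /(_ ltac:(lia)).
  rewrite (eq_bigl [in [predU J1 & T]]) => [|i]; last by rewrite !inE.
  rewrite bigU //=.
  have -> : \sum_(i in J1) v (lift ord0 i) 0 = #|J1|%:R * v0 - D1.
    by rewrite /D1 sumrB sumr_const mulr_natl subKr.
  by rewrite [in X in _ <= X -> _]tE natrD -/v0 -/(f _) => ?; rewrite /f; lra.
rewrite -(ler_pM2l t0); apply: le_trans sub _.
have -> : t.+1%:R * (#|F|%:R * (t%:R / t.+1%:R) * v0 + L * D1) =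
   #|F|%:R * t%:R * v0 + t.+1%:R * L * D1.
  by field; rewrite addrC natr1 lt0r_neq0.
have : #|F|%:R * D1 <= t.+1%:R * L * D1.
  apply: ler_wpM2r => //; apply: (@le_trans _ _ L).
    by apply: le_trans dL; rewrite ler_nat; lia.
  by rewrite ler_peMl // ler1n.
by lra.
Qed.

End UpperBound.

(** * Matching bounds at every level by induction on r *)

Section Recursion.
Variables (R : realType) (k s : nat).
Hypotheses (k0 : (0 < k)%N) (sk : (s <= k)%N)
  (ks : (k.*2 <= (k - s).+1 * (k - s).+2)%N).
Local Notation d := k.*2.

Let coord_bounds := lifted_coord_bounds (lifted_coord0_diff R k0 sk ks).

Lemma card_free (J0 J1 : {set 'I_d}) : J0 :&: J1 = finset.set0 ->
  #|~: (J0 :|: J1)| = (d - #|J0| - #|J1|)%N.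
Proof.
move=> J01; have := cardsC (J0 :|: J1).
by rewrite cardsU J01 cards0 card_ord; lia.
Qed.

Lemma free_setU1 (J0 J1 : {set 'I_d}) (i : 'I_d) : J0 :&: J1 = finset.set0 ->
  i \in ~: (J0 :|: J1) ->
  [/\ J0 :&: (i |: J1) = finset.set0, (i |: J0) :&: J1 = finset.set0,
      #|i |: J1| = #|J1|.+1 & #|i |: J0| = #|J0|.+1].
Proof.
move=> J01; rewrite !inE negb_or => /andP[iJ0 iJ1].
rewrite finset.setIUr finset.setIUl J01 !finset.setU0 !cardsU1 iJ0 iJ1.
split=> //; apply/eqP.
  by rewrite finset.setIC setI_eq0 disjoints1.
by rewrite setI_eq0 disjoints1.
Qed.

Lemma pattern_iter_N_plus r (J0 J1 : {set 'I_d}) :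
  (r + #|J0| + #|J1|)%N = s -> J0 :&: J1 = finset.set0 ->
  iter r (@N_plus R d) (@K R d)
    (homog (pattern J0 J1 (lifted_coord R k r #|J0| #|J1|))).
Proof.
elim: r J0 J1 => [|r IH] J0 J1 rs J01; first by apply: pattern_K => //; lia.
have [IH01 IHd] := coord_bounds r.
have [S01 _] := coord_bounds r.+1.
have a01 := S01 _ _ rs.
have b01 : 0 <= lifted_coord R k r #|J0| #|J1|.+1 <= 1 by apply: IH01; lia.
have rs' : (r + #|J0| + #|J1|).+1 = s by lia.
have /andP[gb0 gb1] := IHd _ _ rs'.
have cF := card_free J01.
have F0 : (1 < #|~: (J0 :|: J1)|)%N by rewrite cF; lia.
move: a01 => /=.
set b := lifted_coord R k r #|J0| #|J1|.+1 in b01 gb0 gb1 *.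
set g := lifted_coord R k r #|J0|.+1 #|J1| in gb0 gb1 *.
move=> a01; have D : 0 < 1 - b + g by have /andP[] := b01; lra.
apply: (@N_plus_pattern _ _ _ _ _ _ b g) => //; first exact: ltnW.
- by rewrite divfK // lt0r_neq0.
(* Dividing out 1 - b reduces the condition to m (g - b) <= 1 + (g - b), that is (m - 1) (g - b) <=
   1; this follows from m <= d and the gap bound 1 / (d - 1). *)
- have -> : g / (1 - b + g) - b = (1 - b) * (g - b) / (1 - b + g).
    by field; rewrite lt0r_neq0.
  rewrite mulrA ler_pdivrMr // mulrCA; apply: ler_wpM2l.
    by have /andP[] := b01; lra.
  have mg : (#|~: (J0 :|: J1)|.-1)%:R * (g - b) <= 1.
    apply: (@le_trans _ _ (d.-1%:R * (g - b))).
      by apply: ler_wpM2r => //; rewrite ler_nat cF; lia.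
    have d1 : 0 < d.-1%:R :> R by rewrite ltr0n; lia.
    by rewrite mulrC -ler_pdivlMr // mul1r.
  by rewrite -[#|_|]prednK ?(ltnW F0) // -natr1; lra.
move=> i iF; have [J01i J0i1 c1 c0] := free_setU1 J01 iF.
split; first by rewrite /b -c1; apply: IH => //; rewrite c1; lia.
by rewrite /g -c0; apply: IH => //; rewrite c0; lia.
Qed.

(** Validity for all large L, uniformly in the placement, lets the induction use one common weight
    L' for both families of inequalities below. *)
Lemma facet_iter_N r n0 n1 : (r + n0 + n1)%N = s ->
  exists L0 : R, forall (L : R) (J0 J1 : {set 'I_d}), L0 <= L ->
    #|J0| = n0 -> #|J1| = n1 -> J0 :&: J1 = finset.set0 ->
    dual_cone (iter r (@N R d) (@K R d))
      (facet_vec J0 J1 (lifted_coord R k r n0 n1) L).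
Proof.
elim: r n0 n1 => [|r IH] n0 n1 rs.
  exists d%:R => L J0 J1 dL c0 c1 J01; rewrite -c0 -c1.
  by apply: facet_K => //; lia.
have [L1 IH1] := IH n0 n1.+1 ltac:(lia).
have [L2 IH2] := IH n0.+1 n1 ltac:(lia).
have [IH01 IHd] := coord_bounds r.
have /andP[gb0 _] := IHd n0 n1 ltac:(lia).
have /andP[_ b1] : 0 <= lifted_coord R k r n0 n1.+1 <= 1 by apply: IH01; lia.
rewrite /=.
set b := lifted_coord R k r n0 n1.+1 in gb0 b1 IH1 *.
set g := lifted_coord R k r n0.+1 n1 in gb0 IH2 *.
have D : 0 < 1 - b + g by lra.
pose m : nat := (d - n0 - n1)%N.
have m0 : 0 < m%:R :> R by rewrite ltr0n /m; lia.
have m10 : 0 < m.-1%:R :> R by rewrite ltr0n /m; lia.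
(* The ratio L' / L imposed by [facet_N]. *)
pose q := m.-1%:R * (1 - b + g) / m%:R.
have q0 : 0 < q by rewrite divr_gt0 ?mulr_gt0.
exists (Num.max L1 L2 / q) => L J0 J1 L12 c0 c1 J01.
have cF : #|~: (J0 :|: J1)| = m by rewrite card_free // c0 c1.
have : Num.max L1 L2 <= L * q by rewrite -ler_pdivrMr.
rewrite ge_max => /andP[L1q L2q].
apply: (@facet_N _ _ _ _ _ b g L (L * q)) => //.
- by rewrite cF /m; lia.
- by rewrite cF /q; field; rewrite lt0r_neq0.
move=> i iF; have [J01i J0i1 ci1 ci0] := free_setU1 J01 iF.
by split; [apply: IH1 | apply: IH2]; rewrite ?ci0 ?ci1 ?c0 ?c1.
Qed.

(** At the pattern the penalty terms vanish, so for any admissible L the facet inequality reads m c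
    - m a >= 0. *)
Lemma iter_N_pattern_le r (J0 J1 : {set 'I_d}) (a : R) :
  (r + #|J0| + #|J1|)%N = s -> J0 :&: J1 = finset.set0 ->
  iter r (@N R d) (@K R d) (homog (pattern J0 J1 a)) ->
  a <= lifted_coord R k r #|J0| #|J1|.
Proof.
move=> rs J01 /= Na; have [L0 HL] := facet_iter_N rs.
have := HL L0 J0 J1 (lexx _) erefl erefl J01 _ Na.
rewrite trmulC trmul_sum (facet_vecE _ _ _ _ (fun x => homog (pattern J0 J1 a) x 0)).
under eq_bigr => i _ do rewrite homog_lift.
rewrite sum_facet homog0 mulr1.
have -> : \sum_i (if i \in J1 then -1 else if i \in J0 then 1 else 0) *
    pattern J0 J1 a i 0 = - #|J1|%:R.
  rewrite -sumr_const -sumrN [RHS]big_mkcond; apply: eq_bigr => i _; rewrite mxE.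
  by case: (i \in J1); case: (i \in J0); ring.
have -> : \sum_(i in ~: (J0 :|: J1)) pattern J0 J1 a i 0 = #|~: (J0 :|: J1)|%:R * a.
  rewrite mulr_natl -sumr_const; apply: eq_bigr => i.
  by rewrite !inE negb_or mxE => /andP[/negbTE-> /negbTE->].
have m0 : 0 < #|~: (J0 :|: J1)|%:R :> R by rewrite ltr0n card_free //; lia.
by move=> h; rewrite -(ler_pM2l m0); lra.
Qed.

End Recursion.

(* With u = d/2 - s the hypothesis reads sqrt d <= u + 3/2, i.e.
   d <= (u + 1) (u + 2) + 1/4. *)
Lemma level_bound (R : realType) (k s : nat) : (0 < k)%N ->
  s%:R <= k.*2%:R / 2 - Num.sqrt (k.*2%:R : R) + 3 / 2 ->
  (s <= k)%N /\ (k.*2 <= (k - s).+1 * (k - s).+2)%N.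
Proof.
move=> k0; set q := Num.sqrt _.
have dE : k.*2%:R = 2 * k%:R :> R by rewrite -muln2 natrM mulrC.
have q2 : q ^+ 2 = 2 * k%:R by rewrite sqr_sqrtr ?dE // mulr_ge0 ?ler0n.
have q0 : 0 <= q by apply: sqrtr_ge0.
have k1 : 1 <= k%:R :> R by rewrite ler1n.
rewrite dE => hs.
(* Since q > 1, the hypothesis gives s < k + 1/2. *)
have sk : (s <= k)%N.
  rewrite -ltnS -(ltr_nat R) -natr1.
  have : 1 < q by rewrite -(@ltr_pXn2r _ 2) ?nnegrE ?ler01 // expr1n q2; lra.
  by lra.
(* Passing to a strict inequality with 1 added absorbs the surplus 1/4 by integrality. *)
split=> //; rewrite -ltnS -(ltr_nat R) -natr1 natrM -!natr1 natrB // dE -q2.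
set u : R := k%:R - s%:R; have qu : q <= u + 3 / 2 by rewrite /u; lra.
have : q ^+ 2 <= (u + 3 / 2) ^+ 2 by rewrite ler_pXn2r ?nnegrE //; lra.
by rewrite !expr2; lra.
Qed.

Unset Implicit Arguments.

Theorem theoremA7 (R : realType) (d : nat) (hd2 : (2 <= d)%N) (hd : ~~ odd d)
    (r n0 n1 : nat)
    (hs : (r + n0 + n1)%:R <= d%:R / 2 - Num.sqrt (d%:R : R) + 3 / 2) :
  exists a : R, is_c d r n0 n1 a /\ is_c_plus d r n0 n1 a.
Proof.
have [k dk] : exists k, d = k.*2 by exists d./2; rewrite even_halfK.
subst d; have k0 : (0 < k)%N by lia.
have [sk ks] := level_bound k0 hs.
exists (lifted_coord R k r n0 n1).
(* Attainment is proved for the smaller set N_+^r(K) and maximality for the larger N^r(K); the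
   inclusion transfers each to the other operator. *)
split=> J0 J1 c0 c1 J01; subst n0 n1; split.
- by apply: iter_N_plus_sub_N; apply: (pattern_iter_N_plus R k0 sk ks).
- by move=> b; apply: (iter_N_pattern_le k0 sk ks).
- exact: (pattern_iter_N_plus R k0 sk ks).
- by move=> b /iter_N_plus_sub_N; apply: (iter_N_pattern_le k0 sk ks).
Qed.
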